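(* For each integer $k\ge 3$, each integer $d$ with $1\le d\le k-2$, every $0<\gamma<1/4$ and every $\epsilon>0$ there exists $n_0$ such that the following holds for all $n\ge n_0$. Suppose that $\mathcal{H}$ is a $k$-graph on $n$ vertices such that for all but at most $\epsilon \binom{n}{d}$ sets $S\in\binom{V(\mathcal{H})}{d}$, \[ \deg(S)\ge \left( \frac{k-d}{k} - \frac{1}{k^{k-d}}+\gamma \right) \binom{n-d}{k-d}. \] Then $\mathcal{H}$ contains a matching that covers all but at most $2 \epsilon^{1/k}n$ vertices.
   Context: A $k$-graph is a pair $(V,E)$ with $E\subseteq\binom{V}{k}$; $\deg(S)$ is the number of edges containing $S$. A matching is a set of pairwise disjoint edges. *)

(* Defs.v *)
From mathcomp Require Import all_boot all_order all_algebra.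
From mathcomp Require Import reals exp.

Set Implicit Arguments.
Unset Strict Implicit.
Unset Printing Implicit Defensive.

Import Order.TTheory GRing.Theory Num.Theory.

Local Open Scope ring_scope.

Section Hypergraphs.
Variable V : finType.
Implicit Types (E M : {set {set V}}) (S : {set V}).

(* A hypergraph on the vertex set [set: V] is given by its edge set E. *)
Definition is_kgraph (k : nat) E : Prop := forall e, e \in E -> #|e| = k.

Definition hdeg E S : nat := #|[set e in E | S \subset e]|.

Definition is_matching E M : Prop := M \subset E /\ trivIset M.

End Hypergraphs.

Definition deg_threshold (R : realType) (n k d : nat) (gamma : R) : R :=
  ((k%:R - d%:R) / k%:R - 1 / k%:R ^+ (k - d) + gamma) * 'C(n - d, k - d)%:R.

Definition low_degree_sets (R : realType) (V : finType) (E : {set {set V}})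
    (d : nat) (t : R) : {set {set V}} :=
  [set S : {set V} | (#|S| == d) && ~~ (t <= (hdeg E S)%:R)].

(* Main.v *)
Require Import Defs.
From mathcomp Require Import all_boot all_order all_algebra.
From mathcomp Require Import reals exp.
From mathcomp Require Import zify ring lra.

(* Let M be a maximum matching, U the set of uncovered vertices and r = k - d, and
   suppose |U| > 2 eps^(1/k) n. Then a positive proportion of the d-tuples in U
   have the required degree. For such a d-set S and an r-tuple v of vertices, the
   pattern of (S, v) is the set of x in [k]^r for which S together with the
   vertices v_i, shifted by x_i along their matching edges, is an edge. By the
   degree condition the average pattern has more than r k^(r-1) - 1 elements, so
   a positive proportion of all patterns have at least r k^(r-1) elements. By
   pigeonhole and the Erdos box theorem a large complete k-partite family of
   vertices, using distinct matching edges, has one and the same pattern P with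
   |P| >= r k^(r-1). A suitable subset Q of P, blown up inside this family, gives
   |Q| disjoint edges that meet fewer than |Q| edges of M and otherwise lie in U,
   contradicting the maximality of M. *)

Set Implicit Arguments.
Unset Strict Implicit.
Unset Printing Implicit Defensive.

(** * Complete multipartite configurations in dense relations *)

Lemma large_fiber (Y K : finType) (f : Y -> K) (A : {set Y}) :
  (0 < #|A|)%N ->
  exists c, (#|A| <= #|[set y in A | f y == c]| * #|K|)%N.
Proof.
case/card_gt0P => y0 _.
pose F c := #|[set y in A | f y == c]|.
case: (@arg_maxnP K (f y0) predT F isT) => c _ Fc.
exists c; rewrite mulnC -sum_nat_const -sum1_card.
rewrite (partition_big f predT) //=.
apply: leq_sum => b _; rewrite sum1dep_card.
by apply: leq_trans (Fc b isT); rewrite /F.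
Qed.

(** Greedy choice: each forbidden or already used key excludes at most [q] elements, and [G] is too
    large to be exhausted this way. *)
Lemma pick_distinct_keys (T K : finType) (key : T -> K) (q L : nat)
    (G : {set T}) (F : {set K}) :
  (forall c, (#|[set x | key x == c]| <= q)%N) ->
  (q * (L + #|F|) < #|G|)%N ->
  exists s : L.-tuple T, [/\ {subset s <= G}, uniq (map key s)
    & {in s, forall x, key x \notin F}].
Proof.
move=> fib; elim: L => [|L IH] leG; first by exists [tuple]; split.
have [|s [sG us sF]] := IH; first by nia.
pose F' := F :|: [set c in map key s].
have cF' : (#|F'| <= #|F| + L)%N.
  apply: leq_trans (leq_card_setU _ _) _; rewrite leq_add2l cardsE.
  by apply: leq_trans (card_size _) _; rewrite size_map size_tuple.
have [x xG xF'] : exists2 x, x \in G & key x \notin F'.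
  case: (boolP [exists x in G, key x \notin F']) => [/exists_inP//|/exists_inPn noG].
  have: (#|G| <= q * #|F'|)%N.
    rewrite mulnC -sum_nat_const -[#|G|]sum1_card (partition_big key (mem F')) /=.
      apply: leq_sum => c _; apply: leq_trans (fib c).
      by rewrite sum1dep_card; apply/subset_leq_card/subsetP => x; rewrite !inE => /andP[].
    by move=> x /noG; rewrite negbK.
  by nia.
exists [tuple of x :: s]; split.
- by move=> y; rewrite inE => /predU1P[->//|/sG].
- by move: xF'; rewrite /= !inE negb_or us andbT => /andP[].
- move=> y; rewrite inE => /predU1P[->|/sF//].
  by move: xF'; rewrite !inE negb_or => /andP[].
Qed.

(** Double counting in the style of Kővári, Sós and Turán. From boundedly many [x] of large degree
    with distinct keys, pigeonhole on the traces of the [y] selects [m] that share a positive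
    proportion of [Y]. *)
Lemma common_neighbourhood (T Y K : finType) (key : T -> K) (q m a : nat)
    (S : {set T * Y}) (F : {set K}) :
  (0 < a)%N -> (0 < m)%N -> (0 < #|Y|)%N ->
  (forall c, (#|[set x | key x == c]| <= q)%N) ->
  (2 * a * (q * (4 * a * m + #|F|)) < #|T|)%N ->
  (#|T| * #|Y| <= a * #|S|)%N ->
  exists s : m.-tuple T, [/\ uniq (map key s),
    {in s, forall x, key x \notin F}
    & (#|Y| <= 4 * a * 2 ^ (4 * a * m)
               * #|[set y | all (fun x => (x, y) \in S) s]|)%N].
Proof.
move=> a0 m0 Y0 fib Tbig Sbig.
pose deg x := #|[set y | (x, y) \in S]|.
have degY x : (deg x <= #|Y|)%N by apply: max_card.
have sumdeg : (\sum_x deg x = #|S|)%N.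
  under eq_bigr do rewrite /deg cardsE -sum1_card.
  rewrite pair_big_dep /= -sum1_card; apply: eq_bigl => -[x y] //.
(* The average degree is at least [#|Y| / a], so at least [#|T| / (2 * a)] elements have half of
   that. *)
pose G := [set x | #|Y| <= 2 * a * deg x]%N.
have Gbig : (#|T| <= 2 * a * #|G|)%N.
  have : (\sum_x 2 * a * deg x <= \sum_x (2 * a * #|Y| * (x \in G) + #|Y|))%N.
    apply: leq_sum => x _; rewrite inE; have := degY x; case: (leqP #|Y| (2 * a * deg x)) => /=; nia.
  rewrite big_split /= -!big_distrr /= sumdeg sum_nat_const.
  rewrite -[X in (_ * _ * X + _)%N]big_mkcond /= sum1_card => h.
  have arith t y g s : (2 * a * s <= 2 * a * y * g + t * y -> t * y <= a * s ->
    0 < y -> t <= 2 * a * g)%N.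
    by move=> h1 h2 y0; rewrite -(leq_pmul2r y0); nia.
  exact: arith h Sbig Y0.
(* With this [L] an average [y] is adjacent to at least [2 * m] of the chosen elements, so a
   proportion [1 / (4 * a)] of all [y] is adjacent to at least [m]. *)
set L := (4 * a * m)%N in Tbig *.
have [|X [XG uX XF]] := @pick_distinct_keys T K key q L G F fib.
  by have := leq_trans Tbig Gbig; rewrite ltn_pmul2l // muln_gt0.
pose N y := [set i : 'I_L | (tnth X i, y) \in S].
have sumN : (\sum_y #|N y| = \sum_(i < L) deg (tnth X i))%N.
  under eq_bigr do rewrite /N cardsE -sum1_card big_mkcond /=.
  rewrite exchange_big /=; apply: eq_bigr => i _.
  by rewrite -big_mkcond /deg cardsE sum1_card.
have degL : (L * #|Y| <= 2 * a * \sum_y #|N y|)%N.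
  rewrite sumN big_distrr /= -{1}(card_ord L) -sum_nat_const.
  apply: leq_sum => i _.
  by have := XG _ (mem_tnth i X); rewrite inE.
pose Y' := [set y | m <= #|N y|]%N.
have NL y : (#|N y| <= L)%N by rewrite -[X in (_ <= X)%N]card_ord max_card.
have Y'big : (#|Y| <= 4 * a * #|Y'|)%N.
  have : (\sum_y #|N y| <= \sum_y (L * (y \in Y') + m))%N.
    apply: leq_sum => y _; rewrite inE; have := NL y; case: (leqP m #|N y|) => /=; nia.
  rewrite big_split /= -!big_distrr /= sum_nat_const.
  rewrite -[X in (_ * X + _)%N]big_mkcond /= sum1_card => h.
  have arith y t sN : (sN <= L * t + y * m -> L * y <= 2 * a * sN ->
    y <= 4 * a * t)%N.
    move=> h1 h2.
    have h3 : (2 * a * sN <= 2 * a * (L * t + y * m))%N by rewrite leq_mul2l h1 orbT.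
    have am : (0 < 2 * a * m)%N by nia.
    by rewrite -(leq_pmul2l am); move: h2 h3; rewrite /L; nia.
  exact: arith h degL.
(* Only [2 ^ L] traces are possible; [B] is a most frequent one. *)
have [|B Bbig] := @large_fiber Y {set 'I_L} N Y'.
  by move: Y'big; case: #|Y'| => //; rewrite muln0 leqNgt Y0.
rewrite -cardsT -powersetT card_powerset cardsT card_ord in Bbig.
have /card_gt0P[y1] : (0 < #|[set y in Y' | N y == B]|)%N.
  move: (leq_trans Y'big (leq_mul (leqnn _) Bbig)).
  by case: #|[set y in Y' | _]| => //; rewrite mul0n muln0 leqNgt Y0.
rewrite !inE => /andP[mN /eqP NB].
have sizeB : size (take m (enum B)) == m.
  by rewrite size_takel // -cardE -NB.
pose s := [tuple of map (tnth X) (Tuple sizeB)].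
exists s; split.
- have inj : injective (key \o tnth X).
    by apply/injectiveP; rewrite /injectiveb /dinjectiveb map_comp map_tnth_enum.
  by rewrite -map_comp (map_inj_uniq inj) take_uniq ?enum_uniq.
- by move=> x /mapP[i _ ->]; apply: XF; apply: mem_tnth.
- apply: leq_trans Y'big _; rewrite -[X in (_ <= X)%N]mulnA leq_pmul2l; last by nia.
  apply: leq_trans Bbig _; rewrite mulnC leq_pmul2l ?expn_gt0 //.
  apply/subset_leq_card/subsetP => y; rewrite !inE => /andP[_ /eqP Ny].
  apply/allP => x /mapP[i iB ->].
  by have := mem_take iB; rewrite mem_enum -Ny inE.
Qed.

(* The Erdos box theorem for n-partite n-graphs: the vertices [w i j] of the
   complete n-partite configuration moreover have pairwise distinct keys and
   avoid the keys in [F], so that the parts are disjoint and, when keys are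
   matching edges, each [w i j] uses its own matching edge. *)
Lemma dense_blowup (n m a q b : nat) : (0 < a)%N -> (0 < m)%N ->
  exists N0, forall (T K : finType) (key : T -> K) (A : {set n.-tuple T})
    (F : {set K}),
  (forall c, (#|[set x | key x == c]| <= q)%N) -> (#|F| <= b)%N ->
  (N0 <= #|T|)%N -> (#|T| ^ n <= a * #|A|)%N ->
  exists w : nat -> nat -> T,
  [/\ forall i j i' j', (i < n)%N -> (j < m)%N -> (i' < n)%N -> (j' < m)%N ->
        key (w i j) = key (w i' j') -> i = i' /\ j = j',
      forall i j, (i < n)%N -> (j < m)%N -> key (w i j) \notin F
    & forall c : nat -> nat, (forall i, (c i < m)%N) ->
        [tuple w i (c i) | i < n] \in A].
Proof.
move=> a0 m0; elim: n a b a0 => [|n IH] a b a0.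
  exists 1%N => T K key A F _ _ /card_gt0P[x0 _].
  rewrite expn0 muln_gt0 => /andP[_ /card_gt0P[z zA]].
  by exists (fun _ _ => x0); split=> // c _; congr (_ \in A): zA; apply: eq_from_tnth => -[].
have a'0 : (0 < 4 * a * 2 ^ (4 * a * m))%N by rewrite !muln_gt0 a0 expn_gt0.
(* The first part is found first; its [m] keys become forbidden for the later parts. *)
have [N0 IHn] := IH _ (m + b)%N a'0.
exists (N0 + (2 * a * (q * (4 * a * m + b))).+1)%N => T K key A F fib Fb Tbig Abig.
pose S := [set p : T * n.-tuple T | [tuple of p.1 :: p.2] \in A].
have SA : (#|A| <= #|S|)%N.
  apply: leq_trans (leq_imset_card (fun p : T * n.-tuple T => [tuple of p.1 :: p.2]) S).
  apply/subset_leq_card/subsetP => z zA; apply/imsetP.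
  exists (thead z, [tuple of behead z]); last by rewrite /= -tuple_eta.
  by rewrite inE /= -tuple_eta.
have [|||s [us sF sbig]] := @common_neighbourhood T _ K key q m a S F a0 m0 _ fib.
- by rewrite card_tuple expn_gt0; lia.
- apply: leq_trans Tbig; apply: leq_trans (leq_addl _ _); rewrite ltnS.
  by rewrite leq_mul2l leq_mul2l leq_add2l Fb !orbT.
- by rewrite card_tuple -expnS; apply: leq_trans Abig _; rewrite leq_mul2l SA orbT.
rewrite card_tuple in sbig.
have [||w [wkey wF wA]] := IHn T K key _ (F :|: [set c in map key s]) fib _ _ sbig.
- apply: leq_trans (leq_card_setU _ _) _; rewrite addnC leq_add // cardsE.
  by apply: leq_trans (card_size _) _; rewrite size_map size_tuple.
- by lia.
have /card_gt0P[x0 _] : (0 < #|T|)%N by apply: leq_trans Tbig; rewrite addnS.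
exists (fun i => if i is i'.+1 then w i' else nth x0 s).
have sk j : (j < m)%N -> nth x0 s j \in s by move=> jm; rewrite mem_nth ?size_tuple.
have swF i j j' : (i < n)%N -> (j < m)%N -> (j' < m)%N ->
    key (nth x0 s j') <> key (w i j).
  move=> ilt jlt j'lt e; have := wF i j ilt jlt; rewrite -e !inE negb_or => /andP[_].
  by rewrite map_f // sk.
split.
- move=> [|i] j [|i'] j' // ilt jlt i'lt j'lt.
  + move=> e; split=> //; apply/eqP.
    rewrite -(nth_uniq (key x0) _ _ us) ?size_map ?size_tuple //.
    by rewrite !(nth_map x0) ?size_tuple // e.
  + by move/swF; case.
  + by move/esym/swF; case.
  + by move/wkey; case=> // -> ->.
- move=> [|i] j ilt jlt; first exact/sF/sk.
  by have := wF i j ilt jlt; rewrite !inE negb_or => /andP[].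
- move=> c cm.
  have := wA (fun i => c i.+1) (fun i => cm i.+1).
  rewrite inE => /allP/(_ _ (sk _ (cm 0%N))); rewrite inE /=.
  congr (_ \in A); apply: eq_from_tnth => i.
  rewrite tnth_mktuple; case: (unliftP ord0 i) => [j|] ->.
    by rewrite tnthS tnth_mktuple.
  by rewrite tnth0.
Qed.

(** * Patterns with a gain *)

Lemma card_box (I K : finType) (D : I -> {set K}) :
  #|[set x : {ffun I -> K} | [forall i, x i \in D i]]| = (\prod_i #|D i|)%N.
Proof.
rewrite cardsE (eq_card (B := family (fun i => mem (D i)))) //.
by rewrite card_family foldrE big_map big_enum.
Qed.

Lemma card_slice (r k : nat) (i : 'I_r) (A : {set 'I_k}) :
  #|[set x : {ffun 'I_r -> 'I_k} | x i \in A]| = (#|A| * k ^ r.-1)%N.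
Proof.
pose D l := if l == i then A else setT.
rewrite (_ : [set _ | _] = [set x : {ffun 'I_r -> 'I_k} | [forall l, x l \in D l]]).
  rewrite card_box (bigD1 i) //= /D eqxx; congr (_ * _)%N.
  under eq_bigr => l /negbTE -> do rewrite cardsT card_ord.
  by rewrite prod_nat_const cardC1 card_ord.
apply/setP => x; rewrite !inE; apply/idP/forallP => [xi l|/(_ i)]; rewrite /D.
  by case: eqP => [->|]; rewrite ?inE.
by rewrite eqxx.
Qed.

Lemma card_slice2 (r k : nat) (i j : 'I_r) (A : {set 'I_k}) (b : 'I_k) :
  i != j ->
  #|[set x : {ffun 'I_r -> 'I_k} | (x i \in A) && (x j == b)]| =
    (#|A| * k ^ r.-2)%N.
Proof.
move=> ij; pose D l := if l == i then A else if l == j then [set b] else setT.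
rewrite (_ : [set _ | _] = [set x : {ffun 'I_r -> 'I_k} | [forall l, x l \in D l]]).
  rewrite card_box (bigD1 i) //= (bigD1 j) 1?eq_sym //= /D eqxx.
  rewrite eq_sym (negbTE ij) eqxx cards1 mul1n; congr (_ * _)%N.
  under eq_bigr => l /andP[/negbTE -> /negbTE ->] do rewrite cardsT card_ord.
  rewrite prod_nat_const; congr (_ ^ _)%N.
  rewrite (eq_card (B := ~: [set i; j])); last by move=> l; rewrite !inE negb_or.
  by rewrite cardsCs setCK cards2 ij card_ord subn2.
apply/setP => x; rewrite !inE; apply/andP/forallP => [[xi xj] l|h]; rewrite /D.
  by case: eqP => [->|_] //; case: eqP => [->|]; rewrite ?inE.
by have := h i; have := h j; rewrite /D eqxx eq_sym (negbTE ij) eqxx inE.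
Qed.

(* [Q] blown up uses one new edge per element of [Q] and, for each active
   coordinate [i], only [D i] copies of the old matching edge. Taking [Q = P] and
   [D] constantly [k ^ r.-1] gains when some coordinate is inactive. Otherwise
   call [a] full at [i] if the whole slice [x i = a] lies in [P]: no full value
   at some [i] lowers [D i] by one; [r] full values at some [i] give a slab with
   [D i = r * k ^ r.-2] at the other coordinates, and [k > r] makes this a gain;
   in the remaining case [r.-1] deletions meet all full slices and lower every
   [D i] by one. *)
Lemma pattern_gain (r k : nat) (P : {set {ffun 'I_r -> 'I_k}})
    (I : {set 'I_r}) :
  (2 <= r < k)%N -> (r * k ^ r.-1 <= #|P|)%N ->
  exists (Q : {set {ffun 'I_r -> 'I_k}}) (D : 'I_r -> nat),
  [/\ Q \subset P, forall i a, (#|[set x in Q | x i == a]| <= D i)%N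
    & (\sum_(i in I) D i < #|Q|)%N].
Proof.
case/andP=> r2 rk Pbig.
have k0 : (0 < k ^ r.-1)%N by rewrite expn_gt0; lia.
have slice i a : #|[set x : {ffun 'I_r -> 'I_k} | x i == a]| = (k ^ r.-1)%N.
  rewrite -[RHS]mul1n -(cards1 a) -(card_slice i).
  by apply: eq_card => x; rewrite !inE.
have degle (Q : {set {ffun 'I_r -> 'I_k}}) i a :
    (#|[set x in Q | x i == a]| <= k ^ r.-1)%N.
  rewrite -(slice i a); apply/subset_leq_card/subsetP => x.
  by rewrite !inE => /andP[].
have deglt (Q : {set {ffun 'I_r -> 'I_k}}) (x : {ffun 'I_r -> 'I_k}) i a :
    x i = a -> x \notin Q ->
    (#|[set x in Q | x i == a]| <= (k ^ r.-1).-1)%N.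
  move=> xi xQ; rewrite -ltnS prednK // -(slice i a); apply/proper_card/properP.
  split; first by apply/subsetP => z; rewrite !inE => /andP[].
  by exists x; rewrite !inE ?xi ?eqxx // (negbTE xQ).
have [IT|/eqP IT] := eqVneq I setT; last first.
  exists P, (fun=> k ^ r.-1)%N; split=> //; apply: leq_trans Pbig.
  rewrite sum_nat_const ltn_pmul2r // -[X in (_ < X)%N]card_ord -cardsT.
  by apply: proper_card; rewrite properEneq subsetT andbT; apply/eqP.
pose F i := [set a | [forall x : {ffun 'I_r -> 'I_k}, (x i == a) ==> (x \in P)]].
have nF i a : a \notin F i -> (#|[set x in P | x i == a]| <= (k ^ r.-1).-1)%N.
  rewrite inE negb_forall => /existsP[x]; rewrite negb_imply => /andP[/eqP xi].
  exact: deglt.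
have [/existsP[i0 /eqP F0]|/existsPn Fn0] := boolP [exists i, F i == set0].
  exists P, (fun i => if i == i0 then (k ^ r.-1).-1 else k ^ r.-1)%N.
  split=> // [i a|].
    by case: eqP => [->|//]; apply: nF; rewrite F0 inE.
  apply: leq_trans Pbig; rewrite IT (eq_bigl predT); last by move=> l; rewrite inE.
  rewrite (bigD1 i0) //= eqxx.
  under eq_bigr => l /negbTE e do rewrite e.
  rewrite sum_nat_const cardC1 card_ord.
  by case: (r) k0 r2 => // r' k0' _ /=; rewrite mulSn ltn_add2r prednK.
have [/existsP[i0 Fi0]|/existsPn Flt] := boolP [exists i, (r <= #|F i|)%N].
  have [A [AF cA]] : exists A : {set 'I_k}, A \subset F i0 /\ #|A| = r.
    exists [set a in take r (enum (F i0))]; split.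
      by apply/subsetP => a; rewrite inE => /mem_take; rewrite mem_enum.
    rewrite cardsE (card_uniqP _) ?take_uniq ?enum_uniq //.
    by rewrite size_takel // -cardE.
  exists [set x : {ffun 'I_r -> 'I_k} | x i0 \in A],
    (fun i => if i == i0 then k ^ r.-1 else r * k ^ r.-2)%N; split.
  - apply/subsetP => x; rewrite inE => /(subsetP AF); rewrite inE.
    by move=> /forallP/(_ x); rewrite eqxx.
  - move=> i a; case: eqP => [->|/eqP ii0]; first exact: degle.
    have := @card_slice2 r k i0 i A a; rewrite eq_sym cA => /(_ ii0) <-.
    by apply/subset_leq_card/subsetP => x; rewrite !inE.
  rewrite card_slice cA.
  rewrite IT (eq_bigl predT); last by move=> l; rewrite inE.
  rewrite (bigD1 i0) //= eqxx.
  under eq_bigr => l /negbTE e do rewrite e.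
  rewrite sum_nat_const cardC1 card_ord.
  case: (r) r2 rk => [|[|r']] // _ rk' /=.
  have : (0 < k ^ r')%N by rewrite expn_gt0; lia.
  by rewrite expnS; nia.
(* Now every coordinate has at least one and at most [r.-1] full values. The point [y t] takes the
   [t]-th full value in all coordinates at once, or [v i] when the list has run out, so these [r.-1]
   points meet every full slice. *)
have /fin_all_exists[v vF] : forall i, exists a, a \in F i.
  by move=> i; apply/set0Pn.
pose y (t : 'I_r.-1) : {ffun 'I_r -> 'I_k} := [ffun i => nth (v i) (enum (F i)) t].
have yP t i : y t i \in F i.
  rewrite ffunE; have [lt|ge] := ltnP t (size (enum (F i))).
    by rewrite -mem_enum mem_nth.
  by rewrite nth_default.
have cZ : (#|[set y t | t : 'I_r.-1]| <= r.-1)%N.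
  by rewrite -[X in (_ <= X)%N]card_ord; apply: leq_imset_card.
exists (P :\: [set y t | t : 'I_r.-1]), (fun=> (k ^ r.-1).-1); split.
- exact: subsetDl.
- move=> i a; have [aF|/nF] := boolP (a \in F i); last first.
    apply: leq_trans; apply/subset_leq_card/subsetP => x.
    by rewrite !inE => /andP[/andP[_ ->] ->].
  have ti : (index a (enum (F i)) < r.-1)%N.
    have := Flt i; rewrite -ltnNge cardE => lt.
    have : (index a (enum (F i)) < size (enum (F i)))%N.
      by rewrite index_mem mem_enum.
    by case: (r) lt => // r'; rewrite ltnS; lia.
  apply: (deglt _ (y (Ordinal ti))); first by rewrite ffunE nth_index ?mem_enum.
  by rewrite inE imset_f.
rewrite sum_nat_const IT cardsT card_ord.
have := cardsID [set y t | t : 'I_r.-1] P.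
have : (#|P :&: [set y t | t : 'I_r.-1]| <= r.-1)%N.
  by apply: leq_trans cZ; apply/subset_leq_card/subsetIr.
(* The gain is exactly one: [r * K - (r - 1) = r * (K - 1) + 1]. *)
have arith K p pz pd : (0 < K -> r * K <= p -> pz <= r.-1 -> pz + pd = p ->
    r * K.-1 < pd)%N by case: K => // K _; nia.
by move=> h1 h2; exact: arith k0 Pbig h1 h2.
Qed.

(** * Blowing up a pattern to enlarge a matching *)

Section Shift.
Variables (V : finType) (M : {set {set V}}).

(* [vshift v] lists cyclically the matching edge containing [v], starting at [v];
   uncovered vertices are fixed. For fixed [x] the map [vshift^~ x] permutes the
   vertices, so averaging over shifts replaces averaging over [r]-tuples of
   matching edges and treats covered and uncovered vertices alike. *)
Definition block v := if v \in cover M then pblock M v else [set v].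

Definition vshift v (x : nat) :=
  nth v (enum (block v)) ((index v (enum (block v)) + x) %% #|block v|).

Lemma mem_block v : v \in block v.
Proof. by rewrite /block; case: ifP => vM; rewrite ?mem_pblock ?set11. Qed.

Lemma card_block_gt0 v : 0 < #|block v|.
Proof. by apply/card_gt0P; exists v; apply: mem_block. Qed.

Lemma mem_vshift v x : vshift v x \in block v.
Proof. by rewrite /vshift -mem_enum mem_nth // -cardE ltn_mod card_block_gt0. Qed.

Lemma vshift_uncovered v x : v \notin cover M -> vshift v x = v.
Proof.
by move=> vM; apply/set1P; have := mem_vshift v x; rewrite /block (negbTE vM).
Qed.

Hypothesis tM : trivIset M.

Lemma block_eq u v : u \in block v -> block u = block v.
Proof.
rewrite {1 3}/block; case: ifP => vM; last by move/set1P->; rewrite /block vM.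
move=> uv; rewrite /block (same_pblock tM uv) ifT //.
by apply/bigcupP; exists (pblock M v); rewrite ?pblock_mem.
Qed.

Lemma block_vshift v x : block (vshift v x) = block v.
Proof. exact/block_eq/mem_vshift. Qed.

Lemma block_covered e v : e \in M -> v \in e -> block v = e.
Proof.
move=> eM ve; rewrite /block ifT; last by apply/bigcupP; exists e.
exact: def_pblock.
Qed.

(** The image stays in the block and so determines it; inside one block the map is a rotation. *)
Lemma vshift_inj x : injective (vshift^~ x).
Proof.
move=> u v /= e; have euv : block u = block v by rewrite -(block_vshift u x) e block_vshift.
move: e; rewrite /vshift euv (set_nth_default v); last first.
  by rewrite -cardE ltn_mod card_block_gt0.
move/eqP; rewrite nth_uniq ?enum_uniq -?cardE ?ltn_mod ?card_block_gt0 //.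
have uv : u \in enum (block v) by rewrite mem_enum -euv mem_block.
have vv : v \in enum (block v) by rewrite mem_enum mem_block.
rewrite eqn_modDr !modn_small ?[X in _ < X]cardE ?index_mem //.
by move/eqP/(index_inj v); apply.
Qed.

Variable k : nat.
Hypothesis cardM : forall e, e \in M -> #|e| = k.

(** The block of a covered vertex has exactly [k] elements, so offsets below [k] do not wrap around.
    Hence new edges with different offsets can share a copy at an active coordinate. *)
Lemma vshift_offset_inj v (x y : 'I_k) : v \in cover M -> vshift v x = vshift v y -> x = y.
Proof.
move=> vM /eqP; have bk : #|block v| = k by rewrite /block vM cardM ?pblock_mem.
rewrite nth_uniq ?enum_uniq -?cardE ?ltn_mod ?card_block_gt0 // bk.
by rewrite eqn_modDl !modn_small // => /eqP/val_inj.
Qed.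

(** This bound lets [block] serve as the key, with [q = k], in the box theorem. *)
Lemma card_block_fiber c : 0 < k -> #|[set v | block v == c]| <= k.
Proof.
move=> k0; have [->|[v]] := set_0Vmem [set v | block v == c]; first by rewrite cards0.
rewrite inE => /eqP <-.
apply: (@leq_trans #|block v|).
  by apply/subset_leq_card/subsetP => u; rewrite inE => /eqP <-; apply: mem_block.
by rewrite /block; case: ifP => vM; rewrite ?cards1 // cardM ?pblock_mem.
Qed.

Variables (E : {set {set V}}) (d r m : nat).
Hypotheses (k0 : 0 < k) (kE : is_kgraph k E) (ME : M \subset E).

Definition offset (x : {ffun 'I_r -> 'I_k}) (s : 'I_d + 'I_r) : nat :=
  if s is inr i then x i else 0.

Definition shifted_edge (z : 'I_d + 'I_r -> V) x := [set vshift (z s) (offset x s) | s : ('I_d + 'I_r)%type].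

(* The first [d] coordinates of [w] are uncovered and the coordinate [inr i] is
   covered iff [i] is active. The edge built from [x] uses its own copy [idx x]
   at uncovered coordinates; at an active coordinate [i], edges with distinct
   [x i] may share a copy, so the rank of [x] in its slice suffices. *)
Lemma augment (w : 'I_d + 'I_r -> nat -> V) (I : {set 'I_r})
    (Q : {set {ffun 'I_r -> 'I_k}}) (D : 'I_r -> nat) :
  (forall s j s' j', j < m -> j' < m -> block (w s j) = block (w s' j') ->
     s = s' /\ j = j') ->
  (forall i j, j < m -> w (inl i) j \notin cover M) ->
  (forall i j, j < m -> (w (inr i) j \in cover M) = (i \in I)) ->
  #|Q| <= m ->
  (forall c x, (forall s, c s < m) -> x \in Q ->
     shifted_edge (fun s => w s (c s)) x \in E) ->
  (forall i a, #|[set x in Q | x i == a]| <= D i) ->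
  \sum_(i in I) D i < #|Q| ->
  exists M', is_matching E M' /\ #|M| < #|M'|.
Proof.
move=> wkey wU wI Qm wE QD DQ.
pose sl i (x : {ffun 'I_r -> 'I_k}) := [set z in Q | z i == x i].
pose idx x := index x (enum Q).
pose rk i (x : {ffun 'I_r -> 'I_k}) := index x (enum (sl i x)).
pose c x s := match s : 'I_d + 'I_r with
  | inr i => if i \in I then rk i x else idx x | inl _ => idx x end.
have idxm x : x \in Q -> idx x < m.
  by move=> xQ; apply: leq_trans Qm; rewrite cardE index_mem mem_enum.
have rksl i x : x \in Q -> rk i x < #|sl i x|.
  by move=> xQ; rewrite cardE index_mem mem_enum inE xQ eqxx.
have rkm i x : x \in Q -> rk i x < m.
  move=> xQ; apply: leq_trans (rksl i x xQ) (leq_trans _ Qm).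
  by apply/subset_leq_card/subsetP => y; rewrite inE => /andP[].
have cm x s : x \in Q -> c x s < m.
  by move=> xQ; case: s => [i|i] /=; [|case: ifP => _]; auto.
pose f x := shifted_edge (fun s => w s (c x s)) x.
have fE x : x \in Q -> f x \in E by move=> xQ; apply: wE => // s; apply: cm.
(* A common vertex fixes the coordinate and the copy. An index in [Q] determines [x]; at an active
   coordinate equal offsets put [x] and [y] in the same slice, where the rank determines them. *)
have meet x y v : x \in Q -> y \in Q -> v \in f x -> v \in f y -> x = y.
  move=> xQ yQ /imsetP[s _ ->] /imsetP[s' _ e].
  have [] := wkey s (c x s) s' (c y s') (cm _ _ xQ) (cm _ _ yQ).
    by rewrite -(block_vshift _ (offset x s)) e block_vshift.
  move=> es; subst s' => ec; move: e; rewrite -ec.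
  have idx_inj : idx x = idx y -> x = y.
    by move/(index_inj x); apply; rewrite mem_enum.
  move: ec (cm _ s xQ); case: s => [i|i] /=; first by move/idx_inj.
  case: ifP => iI; last by move/idx_inj.
  move=> erk rm; rewrite /offset => /vshift_offset_inj; rewrite wI // iI => /(_ isT) exy.
  move: erk; rewrite /rk (_ : sl i y = sl i x); last by rewrite /sl exy.
  by move/(index_inj x); apply; rewrite mem_enum !inE ?exy ?eqxx ?xQ ?yQ.
(* The old edges to be given up: those containing a copy that may be used at an active
   coordinate. *)
pose X := \bigcup_(i in I) [set block (w (inr i) j) | j : 'I_(D i)].
have cX : #|X| <= \sum_(i in I) D i.
  rewrite /X; elim/big_ind2: _ => [|A a B b Aa Bb|i _]; first by rewrite cards0.
    by apply: leq_trans (leq_card_setU _ _) _; apply: leq_add.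
  by rewrite -[X in _ <= X]card_ord leq_imset_card.
have old x e v : x \in Q -> e \in M :\: X -> v \in f x -> v \in e -> False.
  move=> xQ /setDP[eM eX] /imsetP[s _ ->] ve.
  have bs : block (w s (c x s)) = e by rewrite -(block_covered eM ve) block_vshift.
  have cov : w s (c x s) \in cover M.
    by apply/bigcupP; exists e; rewrite // -bs mem_block.
  move: cov bs (cm _ s xQ); case: s {ve} => [i|i] /=.
    by move=> cov _ /(wU i); rewrite cov.
  case: ifP => iI cov bs rm; last by rewrite wI // iI in cov.
  case/negP: eX; apply/bigcupP; exists i => //; rewrite -bs.
  have lt : rk i x < D i by apply: leq_trans (rksl i x xQ) (QD _ _).
  by apply/imsetP; exists (Ordinal lt).
(* Nonempty edges are needed so that disjointness implies distinctness when the new matching is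
   counted. *)
have fn0 x : x \in Q -> exists v, v \in f x.
  by move=> xQ; apply/card_gt0P; rewrite (kE (fE _ xQ)).
exists ((M :\: X) :|: [set f x | x in Q]); split; first split.
- rewrite subUset; apply/andP; split; first exact: subset_trans (subsetDl _ _) ME.
  by apply/subsetP => _ /imsetP[x xQ ->]; apply: fE.
- apply/trivIsetP => A B /setUP[AM|/imsetP[x xQ ->]] /setUP[BM|/imsetP[y yQ ->]].
  + by move/trivIsetP: tM; apply; [case/setDP: AM|case/setDP: BM].
  + by move=> _; apply/pred0P => v; apply/negP => /andP[vA vf]; exact: old yQ AM vf vA.
  + by move=> _; apply/pred0P => v; apply/negP => /andP[vf vB]; exact: old xQ BM vf vB.
  + move=> xy; apply/pred0P => v; apply/negP => /andP[vx vy].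
    by move: xy; rewrite (meet x y v) ?eqxx.
- have dis : [disjoint M :\: X & [set f x | x in Q]].
    apply/pred0P => e; apply/negP => /andP[eM /imsetP[x xQ ef]].
    have [v vf] := fn0 x xQ; apply: (old x e v) => //; by rewrite ef.
  have cf : #|[set f x | x in Q]| = #|Q|.
    apply: card_in_imset => x y xQ yQ e; have [v vx] := fn0 x xQ.
    by apply: (meet x y v) => //; rewrite -e.
  have := leq_card_setU (M :\: X) [set f x | x in Q]; rewrite dis => -[_ /eqP ->].
  rewrite cf -(cardsID X M) addnC ltn_add2l.
  exact: leq_ltn_trans (subset_leq_card (subsetIr M X)) (leq_ltn_trans cX DQ).
Qed.

End Shift.

(** * Counting tuples and their patterns *)

Section Patterns.
Variables (V : finType) (E M : {set {set V}}) (k r : nat).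

Definition pattern (S : {set V}) (v : r.-tuple V) : {set {ffun 'I_r -> 'I_k}} :=
  [set x : {ffun 'I_r -> 'I_k} | S :|: [set vshift M (tnth v i) (x i) | i : 'I_r] \in E].

(** For each of the [k ^ r] offsets [x], shifting coordinatewise permutes the tuples, so [x] lies in
    as many patterns as there are tuples completing [S] to an edge. *)
Lemma sum_pattern S : trivIset M ->
  \sum_v #|pattern S v| =
  (k ^ r * #|[set v : r.-tuple V | S :|: [set tnth v i | i : 'I_r] \in E]|)%N.
Proof.
move=> tM; under eq_bigr do rewrite /pattern cardsE -sum1_card big_mkcond.
rewrite exchange_big /=.
rewrite -[k in RHS]card_ord -[X in (_ ^ X * _)%N]card_ord -card_ffun.
rewrite -sum_nat_const; apply: eq_bigr => x _.
rewrite -big_mkcond sum1_card cardsE.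
pose h (v : r.-tuple V) := [tuple vshift M (tnth v i) (x i) | i < r].
have h_inj : injective h.
  move=> u v /(congr1 (fun t => tnth t)) huv; apply: eq_from_tnth => i.
  have := congr1 (fun t => t i) huv; rewrite !tnth_mktuple.
  exact: vshift_inj.
rewrite -[LHS]sum1_card -[RHS]sum1_card [RHS](reindex_inj h_inj) /=.
apply: eq_bigl => v; rewrite !unfold_in /=.
by under [in RHS]eq_imset do rewrite tnth_mktuple.
Qed.

(** Every edge [e] containing [S] yields the [r]! orderings of [e :\: S]. *)
Lemma link_tuples (S : {set V}) : is_kgraph k E -> #|S| + r = k ->
  r`! * hdeg E S <= #|[set v : r.-tuple V | S :|: [set tnth v i | i : 'I_r] \in E]|.
Proof.
move=> kE Sr; rewrite -[X in _ <= X]sum1_card.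
rewrite (partition_big (fun v : r.-tuple V => S :|: [set tnth v i | i : 'I_r]) (mem E)); last first.
  by move=> v; rewrite inE.
rewrite mulnC -sum_nat_const big_mkcond [X in _ <= X]big_mkcond /=.
apply: leq_sum => e _; rewrite inE; case: (boolP (e \in E)) => //= eE.
case: ifP => // Se; rewrite sum1dep_card.
have ce : #|e :\: S| = r by rewrite cardsD (setIidPr Se) kE // -Sr addKn.
rewrite -ffactnn -[X in X ^_ _]ce -card_uniq_tuples.
apply/subset_leq_card/subsetP => v; rewrite !inE => /andP[/allP ve uv].
suff /eqP -> : S :|: [set tnth v i | i : 'I_r] == e by rewrite eE eqxx.
have Tsub : [set tnth v i | i : 'I_r] \subset e :\: S.
  by apply/subsetP => _ /imsetP[i _ ->]; apply/ve/mem_tnth.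
have -> : [set tnth v i | i : 'I_r] = e :\: S.
  apply/eqP; rewrite eqEcard Tsub ce card_imset; last exact/tuple_uniqP.
  exact: eq_leq (esym (card_ord r)).
by rewrite setUC setDE setUIl (setUidPl Se) [~: _ :|: _]setUC setUCr setIT.
Qed.

End Patterns.

(** Each set in [Low] spoils at most its [d]! orderings. *)
Lemma uniq_tuples_avoiding (V : finType) (d : nat) (U : {set V})
    (Low : {set {set V}}) : (forall S, S \in Low -> #|S| = d) ->
  #|U| ^_ d <= #|[set u : d.-tuple V | [&& all (mem U) u, uniq u
      & [set tnth u i | i : 'I_d] \notin Low]]| + d`! * #|Low|.
Proof.
move=> cS; rewrite -(card_uniq_tuples d (mem U)).
pose bad := [set u : d.-tuple V | uniq u & [set tnth u i | i : 'I_d] \in Low].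
rewrite -[X in X <= _](cardsID bad) addnC leq_add //.
  apply/subset_leq_card/subsetP => u; rewrite !inE.
  by case/andP=> h /andP[-> uu]; rewrite uu in h *.
apply: (@leq_trans #|bad|); first exact/subset_leq_card/subsetIr.
rewrite -[X in X <= _]sum1_card mulnC -sum_nat_const.
rewrite (partition_big (fun u : d.-tuple V => [set tnth u i | i : 'I_d]) (mem Low)); last first.
  by move=> v; rewrite inE => /andP[].
apply: leq_sum => S SL.
have -> : d`! = #|S| ^_ d by rewrite cS // ffactnn.
rewrite -(card_uniq_tuples d (mem S)).
rewrite sum1dep_card; apply/subset_leq_card/subsetP => u; rewrite !inE.
move=> /andP[/andP[-> _] /eqP <-]; rewrite andbT; apply/allP => _ /tnthP[i ->].
exact: imset_f.
Qed.

(** Pairs are coloured by their pattern and their set of active coordinates. The number of colours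
    is bounded in terms of [k] and [r], so a most frequent colour is still dense and the box theorem
    applies to it. *)
Lemma dense_patterns_augment (k d r a : nat) :
  0 < d -> 1 < r -> k = d + r -> 0 < a ->
  exists N0, forall (V : finType) (E M : {set {set V}})
    (B : {set d.-tuple V * r.-tuple V}),
  is_kgraph k E -> is_matching E M -> N0 <= #|V| ->
  (forall p i, p \in B -> tnth p.1 i \notin cover M) ->
  (forall p, p \in B ->
     r * k ^ r.-1 <= #|pattern E M k [set tnth p.1 i | i : 'I_d] p.2|) ->
  #|V| ^ k <= a * #|B| ->
  exists M', is_matching E M' /\ #|M| < #|M'|.
Proof.
move=> d0 r1 kdr a0; have k0 : 0 < k by lia.
pose C : finType := ({set {ffun 'I_r -> 'I_k}} * {set 'I_r})%type.
have C0 : 0 < #|C| by apply/card_gt0P; exists (set0, set0).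
have m0 : 0 < k ^ r by rewrite expn_gt0 k0.
have aC0 : 0 < a * #|C| by rewrite muln_gt0 a0.
(* There are [k ^ r] offsets in all, so this many copies suffice for any [Q]; no key is forbidden at
   the start. *)
have [N0 blow] := dense_blowup (d + r) k 0 aC0 m0.
exists N0.+1 => V E M B kE [ME tM] Vbig BU Bpat Bbig.
have cardM e : e \in M -> #|e| = k by move/(subsetP ME)/kE.
pose f (p : d.-tuple V * r.-tuple V) : C :=
  (pattern E M k [set tnth p.1 i | i : 'I_d] p.2, [set i | tnth p.2 i \in cover M]).
have B0 : 0 < #|B|.
  case: #|B| Bbig => //; rewrite muln0 leqn0 expn_eq0; lia.
have [[P I] B'big] := large_fiber f B0.
set B' := [set y in B | _] in B'big.
pose A := [set [tuple of p.1 ++ p.2] | p : d.-tuple V * r.-tuple V in B'].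
have cA : #|A| = #|B'|.
  apply: card_imset => -[u v] [u' v'] /= /(congr1 val)/eqP /=.
  rewrite eqseq_cat ?size_tuple // => /andP[/eqP/val_inj -> /eqP/val_inj ->] //.
have [|||| w [wkey _ wA]] := @blow V {set V} (block M) A set0.
- by move=> c; apply: card_block_fiber.
- by rewrite cards0.
- exact: ltnW.
- by rewrite cA -kdr; apply: leq_trans Bbig _; rewrite -mulnA leq_mul2l mulnC B'big orbT.
pose w' (s : 'I_d + 'I_r) j := w (unsplit s) j.
(* Every choice of copies is a pair of the popular colour; [c'] transfers the choice to plain
   indices, with value 0 out of range. *)
have wB (c : 'I_d + 'I_r -> nat) : (forall s, c s < k ^ r) ->
  exists2 p, p \in B' & (forall i, w' (inl i) (c (inl i)) = tnth p.1 i)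
    /\ (forall i, w' (inr i) (c (inr i)) = tnth p.2 i).
  move=> cm; pose c' n := if insub n is Some o then c (split (o : 'I_(d + r))) else 0.
  have /imsetP[p pB' /(congr1 (@tnth _ _)) e] : [tuple w i (c' i) | i < d + r] \in A.
    by apply: wA => n; rewrite /c'; case: insub => // [|]; rewrite ?cm ?expn_gt0 ?k0.
  have ws s : w' s (c s) = tnth [tuple of p.1 ++ p.2] (unsplit s).
    by rewrite -e tnth_mktuple /c' valK unsplitK.
  exists p => //; split=> i; rewrite ws.
    by rewrite tnth_lshift.
  by rewrite tnth_rshift.
have B'f p : p \in B' -> [/\ p \in B, P = (f p).1 & I = (f p).2].
  by rewrite inE => /andP[-> /eqP ->].
have [p0 p0B'] : exists p, p \in B'.
  by have [p] := wB (fun=> 0) (fun=> m0); exists p.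
have Pbig : r * k ^ r.-1 <= #|P|.
  by have [p0B -> _] := B'f p0 p0B'; apply: Bpat.
have [|Q [D [QP QD DQ]]] := pattern_gain I _ Pbig; first by lia.
apply: (@augment V M tM k cardM E d r (k ^ r) k0 kE ME w' I Q D) => //.
- move=> s j s' j' jm jm' /wkey; case=> // es ->; split=> //.
  by apply: (can_inj unsplitK); apply: val_inj.
- move=> i j jm; have [p pB' [-> _]] := wB (fun=> j) (fun=> jm).
  by have [pB _ _] := B'f p pB'; apply: BU.
- move=> i j jm; have [p pB' [_ ->]] := wB (fun=> j) (fun=> jm).
  by have [pB _ ->] := B'f p pB'; rewrite inE.
- apply: leq_trans (max_card _) _; by rewrite card_ffun !card_ord.
- move=> c x cm xQ; have [p pB' [wl wr]] := wB c cm.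
  have := subsetP QP x xQ; have [pB -> _] := B'f p pB'; rewrite inE.
  congr (_ \in E); apply/setP => v; apply/setUP/imsetP.
    case=> /imsetP[i _ ->]; [exists (inl i)|exists (inr i)] => //.
      by rewrite wl vshift_uncovered // BU.
    by rewrite wr.
  case=> -[i|i] _ ->; [left|right]; apply/imsetP; exists i => //.
    by rewrite wl vshift_uncovered // BU.
  by rewrite wr.
Qed.

(** * Counting *)

Import Order.TTheory GRing.Theory Num.Theory.

Local Open Scope ring_scope.

Lemma bernoulli (R : realFieldType) (t : R) (m : nat) :
  0 <= t <= 1 -> 1 - m%:R * t <= (1 - t) ^+ m.
Proof.
case/andP=> t0 t1; elim: m => [|m IH]; first by rewrite mul0r subr0 expr0.
rewrite exprS -natr1.
have h : 0 <= 1 - t by lra.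
apply: le_trans (ler_wpM2l h IH).
have m0 : 0 <= m%:R :> R by [].
have := mulr_ge0 m0 (mulr_ge0 t0 t0); nra.
Qed.

(** The falling factorial is at least [(x - m) ^ m = x ^ m * (1 - m / x) ^ m], and Bernoulli bounds
    the last factor by [1 - m ^ 2 / x]. *)
Lemma ffact_ge_pow (R : realFieldType) (N m : nat) (x delta : R) :
  0 < x -> x <= N%:R -> delta <= 1 -> m%:R ^+ 2 <= delta * x ->
  x ^+ m * (1 - delta) <= (N ^_ m)%:R.
Proof.
move=> x0 xN d1 mdx.
have mx : m%:R <= x.
  have m2 : m%:R <= m%:R ^+ 2 :> R by rewrite -natrX ler_nat -mulnn; case: (m) => // m'; rewrite leq_pmulr.
  have : delta * x <= x by rewrite ler_piMl // ltW.
  lra.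
have mN : (m <= N)%N by rewrite -(ler_nat R); apply: le_trans mx xN.
apply: (@le_trans _ _ ((x - m%:R) ^+ m)).
  have -> : x - m%:R = x * (1 - m%:R / x) by field; lra.
  rewrite exprMn ler_wpM2l ?exprn_ge0 ?(ltW x0) //.
  apply: le_trans (bernoulli _ _); last first.
    by rewrite divr_ge0 ?(ltW x0) //= ler_pdivrMr // mul1r.
  rewrite lerD2l lerN2 mulrA ler_pdivrMr // -expr2 //.
apply: (@le_trans _ _ (((N - m) ^ m)%N)%:R).
  by rewrite natrX natrB // lerXn2r ?nnegrE ?subr_ge0 ?lerD2r // (le_trans mx).
rewrite ler_nat ffact_prod -[X in (_ ^ X <= _)%N]card_ord -prod_nat_const.
by apply: leq_prod => i _; rewrite leq_sub2l // ltnW.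
Qed.

(** The average pattern exceeds the largest insufficient size [W] by nearly [gamma * k ^ r], while
    no pattern has more than [k ^ r] elements; hence a proportion [gamma / 2] must be large. *)
Lemma many_bad_patterns (R : realType) (V : finType) (E M : {set {set V}})
    (k d r : nat) (gamma : R) (S : {set V}) :
  (0 < d)%N -> (1 < r)%N -> k = (d + r)%N -> 0 < gamma <= 1 ->
  is_kgraph k E -> trivIset M -> #|S| = d ->
  4%:R * k%:R ^+ 2 <= gamma * #|V|%:R ->
  deg_threshold #|V| k d gamma <= (hdeg E S)%:R ->
  gamma / 2%:R * #|V|%:R ^+ r <=
    #|[set v : r.-tuple V | (r * k ^ r.-1 <= #|pattern E M k S v|)%N]|%:R.
Proof.
move=> d0 r1 kdr /andP[g0 g1] kE tM cS nbig Sdeg.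
set b := #|_|; set n := #|V| in nbig Sdeg *.
have k0 : 0 < k%:R :> R by rewrite ltr0n; lia.
have K0 : 0 < k%:R ^+ r :> R by rewrite exprn_gt0.
have n0 : 0 < n%:R :> R.
  have : 0 < 4%:R * k%:R ^+ 2 :> R by rewrite mulr_gt0 ?exprn_gt0.
  by move/lt_le_trans/(_ nbig); rewrite pmulr_rgt0.
pose W : R := r%:R * k%:R ^+ r.-1 - 1.
have up : (\sum_(v : r.-tuple V) #|pattern E M k S v| <= k ^ r * b + n ^ r * (r * k ^ r.-1).-1)%N.
  have pw v : (#|pattern E M k S v| <=
      k ^ r * (v \in [set v : r.-tuple V | (r * k ^ r.-1 <= #|pattern E M k S v|)%N])
      + (r * k ^ r.-1).-1)%N.
    rewrite inE; case: (leqP (r * k ^ r.-1) #|pattern E M k S v|) => h /=.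
      rewrite muln1; apply: leq_trans (leq_addr _ _).
      by apply: leq_trans (max_card _) _; rewrite card_ffun !card_ord.
    by rewrite muln0 add0n -ltnS; apply: leq_trans h (leqSpred _).
  apply: leq_trans (_ : \sum_(v : r.-tuple V) #|pattern E M k S v| <= \sum_(v : r.-tuple V) (k ^ r *
      (v \in [set v : r.-tuple V | (r * k ^ r.-1 <= #|pattern E M k S v|)%N])
      + (r * k ^ r.-1).-1))%N _; first by apply: leq_sum => v _; exact: pw.
  rewrite big_split /= -big_distrr /= -[X in (_ * X + _ <= _)%N]big_mkcond /= sum1_card.
  by rewrite sum_nat_const card_tuple.
have lo : (k ^ r * (r`! * hdeg E S) <= \sum_(v : r.-tuple V) #|pattern E M k S v|)%N.
  by rewrite sum_pattern // leq_mul2l (@link_tuples V E k) ?orbT // cS.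
have key := leq_trans lo up.
have WE : W = (r * k ^ r.-1).-1%:R.
  rewrite -subn1 natrB ?natrM ?natrX // muln_gt0 expn_gt0; lia.
have W0 : 0 <= W by rewrite WE.
have WK : W <= k%:R ^+ r.
  rewrite WE -natrX ler_nat; apply: leq_trans (leq_pred _) _.
  by rewrite -[X in (_ <= _ ^ X)%N](prednK (ltnW r1)) expnS leq_mul2r kdr leq_addl orbT.
(* Here the threshold is explained: [k ^ r * (r / k - 1 / k ^ r)] is exactly [W]. *)
have thr : k%:R ^+ r * (r`! * 'C(n - d, r))%:R *
    ((k%:R - d%:R) / k%:R - 1 / k%:R ^+ r + gamma) =
    ((n - d) ^_ r)%:R * (W + gamma * k%:R ^+ r).
  rewrite -bin_ffact mulnC [X in _ = X]mulrC mulrAC; congr (_ * _).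
  have -> : k%:R - d%:R = r%:R :> R by rewrite kdr natrD; ring.
  have Kr : k%:R ^+ r = k%:R * k%:R ^+ r.-1 :> R by rewrite -exprS (prednK (ltnW r1)).
  rewrite /W Kr; rewrite Kr in K0; field.
  by rewrite (lt0r_neq0 k0) /= lt0r_neq0 // -(pmulr_rgt0 _ k0).
(* Obtained from the bound for [n ^_ k] by cancelling [n ^_ d], which is at most [n ^ d]. *)
have ff : n%:R ^+ r * (1 - gamma / 4%:R) <= ((n - d) ^_ r)%:R :> R.
  have := @ffact_ge_pow R n k n%:R (gamma / 4%:R) n0 (lexx _).
  have g4 : gamma / 4%:R <= 1 by lra.
  have k2 : k%:R ^+ 2 <= gamma / 4%:R * n%:R by lra.
  move=> /(_ g4 k2); 
  have -> : (n ^_ k = n ^_ d * (n - d) ^_ r)%N.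
    rewrite kdr !ffact_prod big_split_ord /=; congr (_ * _)%N.
    by apply: eq_bigr => i _; rewrite subnDA.
  rewrite [X in n%:R ^+ X](_ : k = d + r)%N // exprD natrM => h.
  have nd : 0 < n%:R ^+ d :> R by rewrite exprn_gt0.
  rewrite -(ler_pM2l nd) mulrA; apply: le_trans h _.
  rewrite ler_wpM2r // -natrX ler_nat ffact_prod -[X in (_ <= _ ^ X)%N]card_ord.
  by rewrite -prod_nat_const leq_prod // => i _; apply: leq_subr.
have deg2 : ((n - d) ^_ r)%:R * (W + gamma * k%:R ^+ r) <=
    k%:R ^+ r * b%:R + n%:R ^+ r * W.
  rewrite WE -!natrX -!natrM -natrD; apply: le_trans (_ : _ <= (k ^ r * (r`! * hdeg E S))%:R) _; last by rewrite ler_nat.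
  rewrite natrX -WE -thr !natrM natrX -!mulrA ler_wpM2l ?(ltW K0) // ler_wpM2l //.
  by move: Sdeg; rewrite /deg_threshold kdr addKn mulrC.
have big : n%:R ^+ r * (1 - gamma / 4%:R) * (W + gamma * k%:R ^+ r) <=
    k%:R ^+ r * b%:R + n%:R ^+ r * W.
  apply: le_trans deg2; rewrite ler_wpM2r // addr_ge0 // mulr_ge0 // ltW //.
have nr : 0 <= n%:R ^+ r :> R by rewrite exprn_ge0 // ltW.
rewrite -(ler_pM2l K0).
(* Replacing [(n - d) ^_ r] by [n ^ r] costs at most half of the surplus [gamma * k ^ r]. *)
have : n%:R ^+ r * (gamma / 4%:R * (W + gamma * k%:R ^+ r)) <=
    n%:R ^+ r * (gamma / 4%:R * (2%:R * k%:R ^+ r)).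
  apply: ler_wpM2l => //; apply: ler_wpM2l; first lra.
  have : gamma * k%:R ^+ r <= k%:R ^+ r by rewrite ler_piMl // ltW.
  lra.
move: big; set N := n%:R ^+ r; set K := k%:R ^+ r; set B := b%:R.
move=> h1 h2; nra.
Qed.

Lemma dense_bad_pairs (R : realType) (V : finType) (E M : {set {set V}})
    (k d r : nat) (gamma eps beta : R) :
  (0 < d)%N -> (1 < r)%N -> k = (d + r)%N -> 0 < gamma <= 1 ->
  0 < eps -> 0 < beta -> 2%:R * eps <= beta ^+ d ->
  is_kgraph k E -> trivIset M ->
  4%:R * k%:R ^+ 2 <= gamma * #|V|%:R ->
  4%:R * d%:R ^+ 2 <= beta * #|V|%:R ->
  #|low_degree_sets E d (deg_threshold #|V| k d gamma)|%:R
    <= eps * 'C(#|V|, d)%:R ->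
  beta * #|V|%:R <= #|~: cover M|%:R ->
  exists B : {set d.-tuple V * r.-tuple V},
  [/\ forall p i, p \in B -> tnth p.1 i \notin cover M,
      forall p, p \in B ->
        (r * k ^ r.-1 <= #|pattern E M k [set tnth p.1 i | i : 'I_d] p.2|)%N
    & eps * gamma / 4%:R * #|V|%:R ^+ k <= #|B|%:R].
Proof.
move=> d0 r1 kdr g01 e0 b0 be kE tM nbig1 nbig2 Elow Ubig.
have /andP[g0 g1] := g01.
set Low := low_degree_sets _ _ _ in Elow.
set n := #|V| in nbig1 nbig2 Elow Ubig *.
have cLow S : S \in Low -> #|S| = d by rewrite inE => /andP[/eqP].
pose Good := [set u : d.-tuple V | [&& all (mem (~: cover M)) u, uniq u
      & [set tnth u i | i : 'I_d] \notin Low]].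
have n0 : 0 < n%:R :> R.
  have : 0 < 4%:R * d%:R ^+ 2 :> R by rewrite mulr_gt0 ?exprn_gt0 ?ltr0n.
  by move/lt_le_trans/(_ nbig2); rewrite pmulr_rgt0.
(* At least [3/4 * (beta * n) ^ d], hence [3/2 * eps * n ^ d], injective tuples are uncovered, and
   at most [eps * n ^ d] of them span low sets. *)
have Gbig : eps / 2%:R * n%:R ^+ d <= #|Good|%:R.
  have := @uniq_tuples_avoiding V d (~: cover M) Low cLow.
  rewrite -/Good -(ler_nat R) natrD => h.
  have x0 : 0 < beta * n%:R by rewrite mulr_gt0.
  have := @ffact_ge_pow R #|~: cover M| d (beta * n%:R) (1 / 4%:R) x0 Ubig.
  have q1 : 1 / 4%:R <= 1 :> R by lra.
  have q2 : d%:R ^+ 2 <= 1 / 4%:R * (beta * n%:R) by lra.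
  move=> /(_ q1 q2); rewrite exprMn => h2.
  have h3 : (d`! * #|Low|)%:R <= eps * n%:R ^+ d.
    rewrite natrM; apply: le_trans (_ : d`!%:R * (eps * 'C(n, d)%:R) <= _).
      by rewrite ler_wpM2l.
    rewrite mulrCA ler_wpM2l ?(ltW e0) // -natrM mulnC bin_ffact -natrX ler_nat.
    rewrite ffact_prod -[X in (_ <= _ ^ X)%N]card_ord -prod_nat_const.
    by rewrite leq_prod // => i _; apply: leq_subr.
  have nd : 0 <= n%:R ^+ d :> R by rewrite exprn_ge0 // ltW.
  have h4 := ler_wpM2r nd be.
  lra.
pose B := [set p : d.-tuple V * r.-tuple V | (p.1 \in Good) &&
  (r * k ^ r.-1 <= #|pattern E M k [set tnth p.1 i | i : 'I_d] p.2|)%N].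
exists B; split.
- move=> p i; rewrite inE => /andP[]; rewrite inE => /and3P[/allP U _ _] _.
  by have := U _ (mem_tnth i p.1); rewrite !inE.
- by move=> p; rewrite inE => /andP[].
have -> : #|B| = (\sum_(u in Good) #|[set v : r.-tuple V | (r * k ^ r.-1 <=
    #|pattern E M k [set tnth u i | i : 'I_d] v|)%N]|)%N.
  under eq_bigr do rewrite -sum1_card.
  by rewrite pair_big_dep /= -sum1_card; apply: eq_bigl => -[u v]; rewrite !inE.
have -> : eps * gamma / 4%:R * n%:R ^+ k =
    eps / 2%:R * n%:R ^+ d * (gamma / 2%:R * n%:R ^+ r).
  by rewrite kdr exprD; field.
have t0 : 0 <= gamma / 2%:R * n%:R ^+ r.
  by rewrite mulr_ge0 ?exprn_ge0 ?(ltW n0) //; lra.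
apply: le_trans (ler_wpM2r t0 Gbig) _.
rewrite natr_sum mulr_natl -sumr_const; apply: ler_sum => u.
rewrite inE => /and3P[_ uu uLow].
have cu : #|[set tnth u i | i : 'I_d]| = d.
  by rewrite card_imset; [exact: card_ord | exact/tuple_uniqP].
apply: (@many_bad_patterns R V E M k d r gamma) => //.
by move: uLow; rewrite inE cu eqxx /= negbK.
Qed.

(** * Choice of constants and a maximum matching *)

Theorem theorem2p12 (R : realType) (k d : nat) (gamma eps : R)
    (hk : (3 <= k)%N) (hd : (1 <= d <= k - 2)%N)
    (hgamma : 0 < gamma < 1 / 4%:R) (heps : 0 < eps) :
  exists n0 : nat, forall n : nat, (n0 <= n)%N ->
  forall (V : finType) (E : {set {set V}}),
    #|V| = n -> is_kgraph k E ->
    #|low_degree_sets E d (deg_threshold n k d gamma)|%:R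
      <= eps * 'C(n, d)%:R ->
    exists M : {set {set V}},
      is_matching E M /\
      #|~: cover M|%:R <= 2%:R * eps `^ (k%:R^-1) * n%:R.
Proof.
have d0 : (0 < d)%N by lia.
have [r r1 kdr] : exists2 r, (1 < r)%N & k = (d + r)%N by exists (k - d)%N; lia.
set p := eps `^ (k%:R^-1); set beta := 2%:R * p.
have k0 : k%:R != 0 :> R by rewrite pnatr_eq0; lia.
have p0 : 0 < p by rewrite powR_gt0.
have b0 : 0 < beta by rewrite mulr_gt0.
(* If [beta >= 1], the empty matching already suffices. *)
have [b1|b1] := leP 1 beta.
  exists 0%N => n _ V E <- _ _; exists set0; split.
    split; first exact: sub0set.
    by apply/trivIsetP => A B; rewrite inE.
  by apply: le_trans (ler_peMl _ b1); rewrite ?ler0n // ler_nat max_card.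
have pk : p ^+ k = eps.
  by rewrite -powR_mulrn ?(ltW p0) // /p -powRrM mulVf // powRr1 // ltW.
have p1 : p <= 1 by move: b1; rewrite /beta; lra.
(* Since [p <= 1] and [1 <= d <= k], both [2 <= 2 ^ d] and [p ^ k <= p ^ d] hold. *)
have be : 2%:R * eps <= beta ^+ d.
  rewrite /beta exprMn -pk; apply: ler_pM; rewrite ?exprn_ge0 ?(ltW p0) //.
    by rewrite -[X in X <= _]expr1; apply: ler_weXn2l; [lra|lia].
  by apply: ler_wiXn2l; rewrite ?(ltW p0) //; lia.
have [g0 g1] : 0 < gamma /\ gamma <= 1 by lra.
(* This makes [1 / a] smaller than the density [eps * gamma / 4] of the pairs found below. *)
have [a aP] : exists a, 4%:R / (eps * gamma) < a%:R.
  exists (Num.bound (4%:R / (eps * gamma))).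
  by apply: archi_boundP; rewrite divr_ge0 // mulr_ge0 // ltW.
have a0 : (0 < a)%N.
  rewrite -(ltr_nat R); apply: le_lt_trans aP.
  by rewrite divr_ge0 // mulr_ge0 // ltW.
have [N0 aug] := dense_patterns_augment d0 r1 kdr a0.
have bound (c x : R) : 0 < c -> 0 <= x ->
    exists N, forall m, (N <= m)%N -> x <= c * m%:R.
  move=> c0 x0; exists (Num.bound (x / c)) => m hm.
  rewrite mulrC -ler_pdivrMr //.
  apply: le_trans (ltW (archi_boundP _)) _; first by rewrite divr_ge0 // ltW.
  by rewrite ler_nat.
have [n1 hn1] := bound gamma (4%:R * k%:R ^+ 2) g0 (mulr_ge0 (ler0n _ _) (exprn_ge0 _ (ler0n _ _))).
have [n2 hn2] := bound beta (4%:R * d%:R ^+ 2) b0 (mulr_ge0 (ler0n _ _) (exprn_ge0 _ (ler0n _ _))).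
exists (maxn N0 (maxn n1 n2)) => n; rewrite !geq_max => /and3P[nN0 nn1 nn2] V E cV kE; rewrite -cV => Elow.
pose matching := [pred M : {set {set V}} | (M \subset E) && trivIset M].
have m0 : matching set0.
  by rewrite /= sub0set; apply/trivIsetP => A B; rewrite inE.
case: (arg_maxnP (fun M : {set {set V}} => #|M|) m0) => M /andP[ME tM] maxM.
exists M; split=> //; rewrite leNgt; apply/negP => /ltW Ubig.
have g01 : 0 < gamma <= 1 by rewrite g0.
have [||B [BU Bpat Bbig]] := @dense_bad_pairs R V E M k d r gamma eps beta
  d0 r1 kdr g01 heps b0 be kE tM _ _ Elow Ubig.
- by apply: hn1; rewrite cV.
- by apply: hn2; rewrite cV.
have [||M' [[M'E tM'] MM']] := aug V E M B kE (conj ME tM) _ BU Bpat.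
- by rewrite cV.
- rewrite -(ler_nat R) natrX natrM.
  have eg : 0 < eps * gamma by rewrite mulr_gt0.
  have h : 1 <= a%:R * (eps * gamma / 4%:R).
    by move: aP; rewrite ltr_pdivrMr // => h; lra.
  have V0 : 0 <= #|V|%:R ^+ k :> R by rewrite exprn_ge0.
  apply: le_trans (ler_peMl V0 h) _.
  by rewrite -[X in X <= _]mulrA ler_wpM2l.
have := maxM M'; rewrite /= M'E tM' => /(_ isT) /(leq_trans MM').
by rewrite ltnn.
Qed.
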